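(* Let $L$ be an (oriented) virtual link with diagram $D$ whose all-$A$ ribbon graph $\mathbb{D}$ is orientable. Suppose that $D$ has $n_+$ positive crossings and $n_-$ negative crossings. There are grading preserving isomorphisms $$Kh(\mathbb{D})[-n_-]\{n_+-2n_-\}\cong Kh(L)\quad\text{and}\quad\widetilde{Kh}(\mathbb{D})[-n_-]\{n_+-2n_-\}\cong\widetilde{Kh}(L).$$
   Context: **Ribbon graphs.** A ribbon graph $\mathbb{G}$ (always oriented) is a finite nonempty graph (loops and multiple edges allowed) together with an embedding into a closed oriented surface $\Sigma$ whose complement is a disjoint union of open disks; equivalently, a graph with a cyclic order of the half-edges at each vertex. $\Sigma_{\mathbb{G}}$ is a regular neighborhood of $\mathbb{G}$ in $\Sigma$: one disk per vertex and one band per edge. $F(\mathbb{G})$ is the set of boundary components of $\Sigma_{\mathbb{G}}$. A spanning ribbon subgraph $\mathbb{H}$ has the same vertices, a subset of the edges, and inherited cyclic orders; it has its own $\Sigma_{\mathbb{H}}$ and $F(\mathbb{H})$. **Bigraded groups.** $(M[r]\{s\})^{i,j}=M^{i-r,j-s}$ ($i$ homological, $j$ polynomial grading). $V$ is free abelian on $v_+,v_-$ in bigradings $(0,1),(0,-1)$. Define $m:V\otimes V\to V$ by $v_+\otimes v_+\mapsto v_+$, $v_+\otimes v_-\mapsto v_-$, $v_-\otimes v_+\mapsto v_-$, $v_-\otimes v_-\mapsto 0$, and $\Delta:V\to V\otimes V$ by $v_+\mapsto v_+\otimes v_-+v_-\otimes v_+$, $v_-\mapsto v_-\otimes v_-$.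 **Khovanov homology of a ribbon graph.** Let $\mathbb{G}$ have edges $e_1,\dots,e_n$. For $I=(m_1,\dots,m_n)\in\{0,1\}^n$ let $h(I)=\sum m_i$, let $\mathbb{G}(I)$ be the spanning ribbon subgraph with edge set $\{e_i: m_i=1\}$, $V(\mathbb{G}(I))=V^{\otimes F(\mathbb{G}(I))}[h(I)]\{h(I)\}$, and $CKh(\mathbb{G})=\bigoplus_I V(\mathbb{G}(I))$. If $J$ is obtained from $I$ by changing the $k$th coordinate from $0$ to $1$ (a hypercube edge $\xi:I\to J$), adding the band of $e_k$ merges two boundary components or splits one into two; $d_\xi$ is $m$ (merge) or $\Delta$ (split) on the affected factors and the identity on the others. The differential is $d=\sum_\xi(-1)^{|\{i<k:\,m_i=1\}|}d_\xi$; $Kh(\mathbb{G})$ is the bigraded homology. Reduced version: fix a marked point on the boundary of a vertex disk of $\Sigma_{\mathbb{G}}$ away from all bands; $\widetilde{CKh}(\mathbb{G})$ is the subcomplex in which the factor of the boundary component containing the marked point is $\mathbb{Z}v_-$, with polynomial grading shifted up by $1$; $\widetilde{Kh}(\mathbb{G})$ is its homology. **Virtual links and all-$A$ ribbon graphs.** A virtual link diagram is a closed one-manifold generically immersed in the plane, each double point being marked as a classical crossing (with over/under information) or a virtual crossing. Virtual links are equivalence classes of diagrams under the classical and virtual Reidemeister moves. At a classical crossing whose over-strand runs from SW to NE and under-strand from SE to NW, the $A$-resolution consists of two arcs joining SW to NW and NE to SE; the $B$-resolution joins SW to SE and NW to NE. Resolve every classical crossing by $A$ to obtain closed (immersed)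 curves, and at each classical crossing $x$ place one arrow labeled $x$ on each of the two arcs of the resolution, both directed from the over-strand end to the under-strand end. Take an abstract disk (vertex) bounded by each curve and, for each $x$, glue a band (edge) along two opposite sides to the two arrows labeled $x$ so that the arrow directions agree with one orientation of the boundary of the band. The resulting surface $\Sigma_{\mathbb{D}}$ represents the all-$A$ ribbon graph $\mathbb{D}$; $\mathbb{D}$ is orientable if $\Sigma_{\mathbb{D}}$ is. **Khovanov homology of virtual links (orientable case).** Let $D$ have classical crossings $1,\dots,n$, of which $n_+$ are positive and $n_-$ negative. For $I\in\{0,1\}^n$, $D(I)$ is the collection of closed curves obtained by using the $A$-resolution at crossing $i$ if $m_i=0$ and $B$ if $m_i=1$; $|D(I)|$ is the number of curves. $CKh(D)=\bigoplus_I V^{\otimes|D(I)|}[h(I)]\{h(I)\}[-n_-]\{n_+-2n_-\}$. For a hypercube edge $\xi:I\to J$ at coordinate $k$, $d_\xi$ is $\Delta$ if $|D(J)|=|D(I)|+1$ and $m$ if $|D(J)|=|D(I)|-1$ on the affected curves, the identity elsewhere; the case $|D(I)|=|D(J)|$ does not occur when $\mathbb{D}$ is orientable. The differential is $\sum_\xi(-1)^{\sum_{i<k}m_i}d_\xi$. $Kh(L)=Kh(D)$ is its homology; $\widetilde{Kh}(L)$ is the reduced version, defined from a marked point on $D$ away from crossings as in the ribbon graph case. In the reduced statement the marked point of $\mathbb{D}$ corresponds to that of $D$. *)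

(* Defs.v *)
From HB Require Import structures.
From mathcomp Require Import all_boot all_order perm all_algebra.
From mathcomp Require Import boolp.

Set Implicit Arguments.
Unset Strict Implicit.
Unset Printing Implicit Defensive.

Import GRing.Theory.
Local Open Scope ring_scope.

(** * Bigraded groups and bigraded complexes *)

Definition bigraded := int -> int -> zmodType.

(* M[r]{s} *)
Definition shift (M : bigraded) (r s : int) : bigraded :=
  fun i j => M (i - r) (j - s).

Definition bigraded_iso (M N : bigraded) : Prop :=
  forall i j, exists f : {additive M i j -> N i j}, bijective f.

(* A bounded complex of finitely generated free abelian groups with a chosen
   homogeneous basis; [dcoef s t] is the coefficient of [t] in [d s]. *)
Record complex := Complex {
  basis : finType;
  hdeg : basis -> int;
  qdeg : basis -> int;
  dcoef : basis -> basis -> int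
}.

Definition shift_complex (C : complex) (r s : int) : complex :=
  Complex (fun b : basis C => hdeg b + r) (fun b => qdeg b + s) (@dcoef C).

(* The span of the basis elements satisfying [A]; it is only used when this
   span is stable under the differential. *)
Definition subcomplex (C : complex) (A : pred (basis C)) : complex :=
  @Complex {b : basis C | A b} (fun b => hdeg (val b)) (fun b => qdeg (val b))
    (fun b c => dcoef (val b) (val c)).

Definition chain (C : complex) := {ffun basis C -> int}.

Definition diff (C : complex) (x : chain C) : chain C :=
  [ffun t => \sum_s x s * dcoef s t].

Definition homogeneous (C : complex) (i j : int) (x : chain C) : bool :=
  [forall s, (x s != 0) ==> (hdeg s == i) && (qdeg s == j)].

Definition is_cycle (C : complex) (i j : int) : {pred chain C} :=
  fun x => homogeneous i j x && (diff x == 0).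

Lemma diffB (C : complex) (x y : chain C) : diff (x - y) = diff x - diff y.
Proof.
apply/ffunP => t; rewrite !ffunE -sumrB; apply: eq_bigr => s _.
by rewrite !ffunE mulrBl.
Qed.

Lemma homogeneous_closed (C : complex) i j : zmod_closed (@homogeneous C i j).
Proof.
split=> [|x y /forallP hx /forallP hy].
  by apply/forallP => s; rewrite ffunE eqxx.
apply/forallP => s; apply/implyP; rewrite !ffunE => h.
have [x0|/(implyP (hx s))//] := eqVneq (x s) 0.
by apply: (implyP (hy s)); move: h; rewrite x0 sub0r oppr_eq0.
Qed.

Lemma is_cycle_closed (C : complex) i j : zmod_closed (@is_cycle C i j).
Proof.
have [h0 hB] := @homogeneous_closed C i j.
have d0 : diff (0 : chain C) = 0.
  by rewrite -[in LHS](subrr (0 : chain C)) diffB subrr.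
split=> [|x y /andP[hx /eqP dx] /andP[hy /eqP dy]]; apply/andP; split.
- exact: h0.
- by rewrite d0.
- exact: hB.
- by rewrite diffB dx dy subrr.
Qed.

HB.instance Definition _ (C : complex) i j :=
  GRing.isZmodClosed.Build (chain C) (@is_cycle C i j) (@is_cycle_closed C i j).

Record cycles (C : complex) (i j : int) :=
  Cycle { cycle_val : chain C; _ : cycle_val \in @is_cycle C i j }.

HB.instance Definition _ C i j := [isSub for @cycle_val C i j].
HB.instance Definition _ C i j := [Choice of cycles C i j by <:].
HB.instance Definition _ C i j :=
  [SubChoice_isSubZmodule of cycles C i j by <:].

Definition is_boundary (C : complex) (i j : int) : {pred cycles C i j} :=
  fun z => `[< exists2 y : chain C, homogeneous (i - 1) j y & diff y = val z >].

Lemma is_boundary_closed (C : complex) i j : zmod_closed (@is_boundary C i j).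
Proof.
have [h0 hB] := @homogeneous_closed C (i - 1) j.
split=> [|x y /asboolP[u hu du] /asboolP[v hv dv]]; apply/asboolP.
  exists 0; first exact: h0.
  by rewrite -[in LHS](subrr (0 : chain C)) diffB subrr raddf0.
exists (u - v); first exact: hB.
by rewrite diffB du dv raddfB.
Qed.

HB.instance Definition _ (C : complex) i j :=
  GRing.isZmodClosed.Build (cycles C i j) (@is_boundary C i j)
    (@is_boundary_closed C i j).

Definition homology (C : complex) : bigraded :=
  fun i j => Quotient.quot (@is_boundary C i j).

(** * The algebra V

   The basis vector v_+ is encoded by [true] and v_- by [false]. *)

Definition vdeg (a : bool) : int := if a then 1 else -1.

(* [None] stands for 0. *)
Definition m_ (a b : bool) : option bool :=
  match a, b with
  | true, true => Some true
  | true, false | false, true => Some false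
  | false, false => None
  end.

Definition Delta (a : bool) : seq (bool * bool) :=
  if a then [:: (true, false); (false, true)] else [:: (false, false)].

(** * Cubes of closed curves and their Khovanov complexes

   A vertex of the cube {0,1}^n is encoded by the set of its coordinates equal
   to 1.  The collection of curves at every vertex is presented as a partition
   of a fixed set of points lying on all of them: two points are on the same
   curve when [ccon I] connects them, and every curve contains a point. *)

Record cube := Cube {
  cdim : nat;
  cpoint : finType;
  ccon : {set 'I_cdim} -> rel cpoint
}.

Definition curve_of (Q : cube) (I : {set 'I_(cdim Q)}) (p : cpoint Q) :
    {set cpoint Q} :=
  [set q | connect (ccon I) p q].

Definition curves (Q : cube) (I : {set 'I_(cdim Q)}) : {set {set cpoint Q}} :=
  [set curve_of I p | p in cpoint Q].

(* A basis vector of the summand V^{(x) curves I}: the subset [s.2] of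
   [curves I] consists of the tensor factors v_+, the others being v_-. *)
Definition state (Q : cube) :=
  {s : {set 'I_(cdim Q)} * {set {set cpoint Q}} | s.2 \subset curves s.1}.

Section CubeComplex.
Variable Q : cube.
Implicit Types (s t : state Q) (A B C : {set cpoint Q}).

Definition vertex s : {set 'I_(cdim Q)} := (val s).1.
Definition label s C : bool := C \in (val s).2.

Definition state_hdeg s : int := #|vertex s|%:Z.
Definition state_qdeg s : int :=
  \sum_(C in curves (vertex s)) vdeg (label s C) + #|vertex s|%:Z.

(* Changing a resolution at one place, the curves that are not affected keep
   their sets of points, and a curve produced by a merge or a split never has
   the same points as a curve it came from.  So the affected curves are those
   belonging to only one of the two collections. *)
Definition lost s t := curves (vertex s) :\: curves (vertex t).
Definition gained s t := curves (vertex t) :\: curves (vertex s).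

Definition same_elsewhere s t :=
  [forall C in curves (vertex s) :&: curves (vertex t), label s C == label t C].

Definition merge_coef s t : bool :=
  [exists A, exists B, exists C,
    [&& A != B, lost s t == [set A; B], gained s t == [set C]
      & m_ (label s A) (label s B) == Some (label t C)]].

Definition split_coef s t : bool :=
  [exists A, exists B, exists C,
    [&& B != C, lost s t == [set A], gained s t == [set B; C]
      & (label t B, label t C) \in Delta (label s A)]].

(* The matrix of the map d_xi attached to a hypercube edge xi from [vertex s]
   to [vertex t].  It is 0 if xi neither merges two curves nor splits one. *)
Definition edge_coef s t : int :=
  (same_elsewhere s t && (merge_coef s t || split_coef s t))%:R.

Definition cube_dcoef s t : int :=
  \sum_(k | (k \notin vertex s) && (vertex t == k |: vertex s))
    (-1) ^+ #|[set i in vertex s | (i < k)%N]| * edge_coef s t.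

Definition cube_complex : complex :=
  @Complex (state Q) state_hdeg state_qdeg cube_dcoef.

(* The curve through the marked point [p] carries v_-; the polynomial grading
   is shifted up by 1. *)
Definition reduced_cube_complex (p : cpoint Q) : complex :=
  shift_complex
    (@subcomplex cube_complex
       (fun s : state Q => ~~ label s (curve_of (vertex s) p)))
    0 1.

End CubeComplex.

(** * Ribbon graphs

   The half-edges of the edge [e : 'I_redges] are [(e, false)] and [(e, true)].
   The cycles of [rrot] are the vertices of positive degree, with the cyclic
   order of their half-edges; [risol] is the set of vertices of degree 0. *)

Record ribbon_graph := RibbonGraph {
  redges : nat;
  rrot : {perm ('I_redges * bool)};
  risol : finType;
  ribbon_nonempty : (0 < redges + #|risol|)%N
}.

(* The intervals cut out by the bands on the boundaries of the vertex disks: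
   [inl h] is the one that ends at the half-edge [h] (and starts at the
   half-edge preceding [h]); an isolated vertex has just one, a circle. *)
Definition rarc (G : ribbon_graph) := ('I_(redges G) * bool + risol G)%type.

(* The next interval along the boundary of the surface of the spanning subgraph
   with edge set [I]: at a half-edge of [I] one follows the side of the band and
   arrives just after the other half-edge, at the others one goes straight. *)
Definition boundary_next (G : ribbon_graph) (I : {set 'I_(redges G)})
    (a : rarc G) : rarc G :=
  match a with
  | inl h => inl (rrot G (if h.1 \in I then (h.1, ~~ h.2) else h))
  | inr v => inr v
  end.

(* [curves I] is F(G(I)). *)
Definition ribbon_cube (G : ribbon_graph) : cube :=
  @Cube (redges G) (rarc G) (fun I => frel (boundary_next I)).

Definition Kh_ribbon (G : ribbon_graph) : bigraded :=
  homology (cube_complex (ribbon_cube G)).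

(* The marked point, on the boundary of a vertex disk and away from the bands,
   is given by the interval containing it. *)
Definition rKh_ribbon (G : ribbon_graph) (p : rarc G) : bigraded :=
  homology (@reduced_cube_complex (ribbon_cube G) p).

(** * Virtual link diagrams

   A generically immersed closed one-manifold in the plane is encoded by the
   planar map formed by its double points, plus its components without double
   points.  A crossing has four ends, in counterclockwise order SW, SE, NE, NW;
   the two strands through it are SW-NE and SE-NW. *)

Inductive corner := SW | SE | NE | NW.

Definition corner_code (c : corner) : 'I_4 :=
  match c with SW => inord 0 | SE => inord 1 | NE => inord 2 | NW => inord 3 end.

Definition corner_decode (k : 'I_4) : corner :=
  match val k with 0%N => SW | 1%N => SE | 2%N => NE | _ => NW end.

Lemma corner_codeK : cancel corner_code corner_decode.
Proof. by case; rewrite /corner_decode /= inordK. Qed.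

HB.instance Definition _ := Finite.copy corner (can_type corner_codeK).

Definition opposite (c : corner) : corner :=
  match c with SW => NE | NE => SW | SE => NW | NW => SE end.

Definition counterclockwise (c : corner) : corner :=
  match c with SW => SE | SE => NE | NE => NW | NW => SW end.

Definition resA (c : corner) : corner :=
  match c with SW => NW | NW => SW | NE => SE | SE => NE end.

Definition resB (c : corner) : corner :=
  match c with SW => SE | SE => SW | NW => NE | NE => NW end.

(* An oriented virtual link diagram.  At a classical crossing the strand SW-NE
   is the over-strand.  [mate] joins the ends of crossings by the edges of the
   planar map, and [incoming] tells at which ends the link is oriented towards
   the crossing.  The free circles are the components without double points;
   their orientations play no role.  Planarity is stated by Euler's formula:
   as every component of the map has Euler characteristic at most 2, the
   equality makes all of them spherical. *)
Record vdiagram := VDiagram {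
  nclassical : nat;
  nvirtual : nat;
  nfree : nat;
  crossing := ('I_nclassical + 'I_nvirtual)%type;
  cend := (crossing * corner)%type;
  mate : cend -> cend;
  mateK : involutive mate;
  incoming : pred cend;
  incoming_mate : forall h, incoming (mate h) = ~~ incoming h;
  incoming_opposite :
    forall x c, incoming (x, opposite c) = ~~ incoming (x, c);
  planar :
    (#|{: crossing}|
       + fcard (fun h => ((mate h).1, counterclockwise (mate h).2)) {: cend}
     = fcard mate {: cend}
       + 2 * n_comp [rel h h' : cend | (h.1 == h'.1) || (mate h == h')]
               {: cend})%N;
  diagram_nonempty : (0 < nclassical + nvirtual + nfree)%N
}.

(* Both strands go upwards or both go downwards. *)
Definition positive (D : vdiagram) (x : 'I_(nclassical D)) : bool :=
  @incoming D (inl x, SW) == @incoming D (inl x, SE).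

Definition npos (D : vdiagram) : nat := #|[set x | @positive D x]|.
Definition nneg (D : vdiagram) : nat := #|[set x | ~~ @positive D x]|.

(* The other end of the arc through [h] after resolving the classical crossings,
   by B at those in [I] and by A at the others; the strands go straight through
   virtual crossings. *)
Definition smooth (D : vdiagram) (I : {set 'I_(nclassical D)}) (h : cend D) :
    cend D :=
  match h.1 with
  | inl x => (h.1, if x \in I then resB h.2 else resA h.2)
  | inr _ => (h.1, opposite h.2)
  end.

Definition dpoint (D : vdiagram) := (cend D + 'I_(nfree D))%type.

Definition resolution_adj (D : vdiagram) (I : {set 'I_(nclassical D)}) :
    rel (dpoint D) :=
  fun p q => match p, q with
  | inl h, inl h' => (mate h == h') || (smooth I h == h')
  | _, _ => false
  end.

(* [curves I] is D(I). *)
Definition diagram_cube (D : vdiagram) : cube :=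
  @Cube (nclassical D) (dpoint D) (@resolution_adj D).

Definition Kh_link (D : vdiagram) : bigraded :=
  homology (shift_complex (cube_complex (diagram_cube D))
              (- (nneg D)%:Z) ((npos D)%:Z - 2 * (nneg D)%:Z)).

(* The marked point, away from the crossings, is on the edge ending at [h] if it
   is [inl h], on a free circle otherwise. *)
Definition rKh_link (D : vdiagram) (p : dpoint D) : bigraded :=
  homology (shift_complex (@reduced_cube_complex (diagram_cube D) p)
              (- (nneg D)%:Z) ((npos D)%:Z - 2 * (nneg D)%:Z)).

(** * The all-A ribbon graph *)

(* The half-edges of the band of the classical crossing [x] are the two arrows
   at [x]: [(x, false)], from SW to NW, and [(x, true)], from NE to SE.  This
   is the arrow on the arc of the A-resolution through [h], if any. *)
Definition arrow (D : vdiagram) (h : cend D) : option ('I_(nclassical D) * bool) :=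
  match h.1 with
  | inl x => Some (x, match h.2 with SW | NW => false | NE | SE => true end)
  | inr _ => None
  end.

Definition arrow_tail (b : bool) : corner := if b then NE else SW.
Definition arrow_head (b : bool) : corner := if b then SE else NW.

(* An orientation of the surface of the all-A ribbon graph of [D], i.e.
   orientations of its disks and bands.  [dor h] means that the boundary
   orientation of the vertex disk runs towards the crossing at the end [h]
   of its boundary curve; [bor x] means that the arrows labeled [x] agree with
   the boundary orientation of the band of [x].  As for any gluing, the two
   boundary orientations are opposite along an arrow.  (Disks bounded by free
   circles have no bands, and their orientations play no role.) *)
Record allA_orientation (D : vdiagram) := AllAOrientation {
  dor : cend D -> bool;
  bor : 'I_(nclassical D) -> bool;
  dor_mate : forall h, dor (mate h) = ~~ dor h;
  dor_smooth : forall h, dor (smooth set0 h) = ~~ dor h;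
  dor_bor : forall x b, dor (inl x, arrow_tail b) = ~~ bor x
}.

Section AllA.
Variables (D : vdiagram) (o : allA_orientation D).
Implicit Types (h : cend D) (a : 'I_(nclassical D) * bool).

(* Following the boundary of a vertex disk from the end [h] of a crossing, where
   it runs towards this crossing, to the next such end. *)
Definition allA_step h : cend D := mate (smooth set0 h).

(* The end of the arc of the arrow [a] where the boundary of the disk comes. *)
Definition arrow_in a : cend D :=
  (inl a.1, if dor o (inl a.1, arrow_tail a.2) then arrow_tail a.2
            else arrow_head a.2).

(* The cyclic sequence of the arrows met on the way. *)
Definition arrows_from h : seq ('I_(nclassical D) * bool) :=
  pmap (@arrow D) (orbit allA_step h).

Definition allA_next a := next (arrows_from (arrow_in a)) a.

Lemma resAK : involutive resA. Proof. by case. Qed.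
Lemma oppositeK : involutive opposite. Proof. by case. Qed.

Lemma smooth0K : involutive (@smooth D set0).
Proof.
by case=> [[x|v] c]; rewrite /smooth /= ?in_set0 ?resAK ?oppositeK.
Qed.

Lemma allA_step_inj : injective allA_step.
Proof. by move=> h h' /(can_inj (@mateK D))/(can_inj smooth0K). Qed.

Lemma dor_step h : dor o (allA_step h) = dor o h.
Proof. by rewrite dor_mate dor_smooth negbK. Qed.

Lemma arrow_arrow_in a : arrow (arrow_in a) = Some a.
Proof. by case: a => x []; rewrite /arrow_in /arrow /=; case: ifP. Qed.

Lemma dor_arrow_in a : dor o (arrow_in a).
Proof.
rewrite /arrow_in; case: ifP => // /negbT; rewrite -dor_smooth /smooth /=.
by rewrite in_set0; case: a => x [].
Qed.

Lemma arrow_inK a h : dor o h -> arrow h = Some a -> arrow_in a = h.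
Proof.
case: h => [[x|v] c] //= hc; rewrite /arrow /= => -[<-] /=.
have := dor_smooth o (inl x, c); rewrite /smooth /= in_set0 hc.
by rewrite /arrow_in; case: c hc => /= e; rewrite /= ?e //= => ->.
Qed.

Lemma arrows_from_uniq h : dor o h -> uniq (arrows_from h).
Proof.
move=> oh; have : {in orbit allA_step h, forall g, dor o g}.
  move=> g; rewrite -fconnect_orbit => /iter_findex <-.
  by elim: (findex _ _ _) => //= k; rewrite dor_step.
rewrite /arrows_from; elim: (orbit _ _) (orbit_uniq allA_step h) => //= g s IH.
case/andP=> gs us os; have {}IH : uniq (pmap (@arrow D) s).
  by apply: IH => // g' g's; apply: os; rewrite inE g's orbT.
case eg: (arrow g) => [a|] //=; rewrite IH andbT; apply: contra gs => ha.
have [g' g's eg'] : exists2 g', g' \in s & arrow g' = Some a.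
  by move: ha; rewrite mem_pmap => /mapP[g' ? ?]; exists g'.
rewrite -(arrow_inK (os _ _) eg) ?mem_head //.
by rewrite (arrow_inK (os _ _) eg') // inE g's orbT.
Qed.

Lemma arrows_from_rot h g : g \in orbit allA_step h ->
  exists i, arrows_from g = rot i (arrows_from h).
Proof.
move=> gh; have [i e] :=
  orbit_rot_cycle (cycle_orbit allA_step_inj h) (orbit_uniq _ _) gh.
rewrite /arrows_from e -[in pmap _ (orbit _ h)](cat_take_drop i (orbit _ h)).
rewrite pmap_cat /rot pmap_cat.
exists (size (pmap (@arrow D) (take i (orbit allA_step h)))).
by rewrite drop_size_cat // take_size_cat.
Qed.

Lemma arrows_from_next a :
  exists i, arrows_from (arrow_in (allA_next a))
            = rot i (arrows_from (arrow_in a)).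
Proof.
apply: arrows_from_rot.
have : allA_next a \in arrows_from (arrow_in a).
  rewrite /allA_next mem_next mem_pmap -arrow_arrow_in map_f //.
  exact: in_orbit.
rewrite mem_pmap => /mapP[g gh eg].
suff -> : arrow_in (allA_next a) = g by [].
apply: arrow_inK => //; move: gh; rewrite -fconnect_orbit => /iter_findex <-.
by elim: (findex _ _ _) => [|k /=]; rewrite ?dor_arrow_in ?dor_step.
Qed.

Lemma allA_next_inj : injective allA_next.
Proof.
apply: (can_inj (g := fun b => prev (arrows_from (arrow_in b)) b)) => a.
have [i ->] := arrows_from_next a.
have u := arrows_from_uniq (dor_arrow_in a).
by rewrite prev_rot // /allA_next prev_next.
Qed.

(* The curves of the all-A resolution without arrows. *)
Definition arrowless (C : {set dpoint D}) : bool :=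
  (C \in curves (Q := diagram_cube D) set0)
  && [forall h, (inl h \in C) ==> ~~ arrow h].

Lemma allA_nonempty : (0 < nclassical D + #|{: {C | arrowless C}}|)%N.
Proof.
case: (posnP (nclassical D)) => [n0|]; last by move=> n0; rewrite addn_gt0 n0.
have noarrow h : ~~ arrow h.
  by case: h => [[[x xn]|v] c] //; exfalso; move: xn; rewrite n0.
have [p _] : exists p : dpoint D, true.
  have := diagram_nonempty D; rewrite n0 add0n addn_gt0 => /orP[v0|f0].
    by exists (inl (inr (Ordinal v0), SW)).
  by exists (inr (Ordinal f0)).
rewrite addn_gt0; apply/orP; right; apply/card_gt0P.
suff Cp : arrowless (curve_of (Q := diagram_cube D) set0 p) by exists (Sub _ Cp).
apply/andP; split; first exact: imset_f.
by apply/forallP => h; rewrite noarrow implybT.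
Qed.

(* Its edges are numbered as the classical crossings of [D]. *)
Definition allA_graph : ribbon_graph :=
  RibbonGraph (perm allA_next_inj) allA_nonempty.

(* The marked point [q] of the all-A ribbon graph corresponds to the marked
   point [p] of [D]: either [q] is the interval ending at the first arrow met
   from [p] along the boundary of the vertex disk, or [q] is the boundary circle
   of an isolated vertex and contains [p]. *)
Definition corresponding (p : dpoint D) (q : rarc allA_graph) : Prop :=
  match q with
  | inl a => exists2 h,
      p = inl h & ohead (arrows_from (if dor o h then h else mate h)) = Some a
  | inr C => p \in val C
  end.

Lemma corresponding_total p : exists q, corresponding p q.
Proof.
set C := curve_of (Q := diagram_cube D) set0 p.
have pC : p \in C by rewrite inE connect0.
have CC : C \in curves (Q := diagram_cube D) set0 by exact: imset_f.
case: p => [h|f] in C pC CC *; last first.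
  suff aC : arrowless C by exists (inr (Sub C aC)).
  rewrite /arrowless CC; apply/forallP => h; rewrite inE.
  by apply/implyP => /connectP[[|q s] //= /andP[]].
pose g := if dor o h then h else mate h.
case eg: (arrows_from g) => [|a s]; last first.
  by exists (inl a), h => //; rewrite -/g eg.
suff aC : arrowless C by exists (inr (Sub C aC)).
have noarrow k : k \in orbit allA_step g -> arrow k = None.
  move=> kg; case ek: (arrow k) => [a|] //.
  have : a \in arrows_from g by rewrite mem_pmap -ek map_f.
  by rewrite eg.
pose S k := (k \in orbit allA_step g) || (mate k \in orbit allA_step g).
have stepb k :
    mate k \in orbit allA_step g -> smooth set0 k \in orbit allA_step g.
  rewrite -!fconnect_orbit => kg.
  by rewrite (same_fconnect1_r allA_step_inj) /allA_step smooth0K.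
have S_arrow k : S k -> ~~ arrow k.
  case/orP => [/noarrow -> //|/stepb/noarrow].
  by case: k => [[x|v] c].
have S_adj k k' : S k -> (mate k == k') || (smooth set0 k == k') -> S k'.
  move=> Sk /orP[] /eqP <-; first by rewrite /S mateK orbC.
  case/orP: Sk => [kg|/stepb kg]; apply/orP; [right|by left].
  move: kg; rewrite -!fconnect_orbit.
  by rewrite [in X in X -> _](same_fconnect1_r allA_step_inj).
have S_C s : forall k q, S k ->
    path (@resolution_adj D set0) (inl k) s -> last (inl k) s = inl q -> S q.
  elim: s => [|[k'|f] s IH] k q Sk //=; first by move=> _ [<-].
  by case/andP => kk' ps; apply: IH ps; apply: S_adj kk'.
rewrite /arrowless CC; apply/forallP => k; rewrite inE.
apply/implyP => /connectP[s ps ek]; apply/S_arrow/(S_C s h k) => //.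
by rewrite /S {1 2}/g; case: ifP => _; rewrite in_orbit ?orbT.
Qed.

End AllA.

(* Main.v *)
From HB Require Import structures.
Require Import Defs.
From mathcomp Require Import all_boot all_order perm all_algebra.
From mathcomp Require boolp.

(** The theorem holds already for chain complexes: resolving the crossings of
the diagram D by B at a set I of crossings, and by A at the others, gives the
boundary of the surface of the spanning subgraph of the all-A ribbon graph with
edge set I, compatibly in I.

To make the compatibility precise, both cubes of curves are compared on points.
A point of D away from the crossings lies on a curve of the all-A resolution,
hence on the boundary of a vertex disk, which the arrows cut into intervals;
sending the point to its interval is a surjection from the points of the cube of
D onto those of the cube of the ribbon graph.  It does not depend on I, and two
points are on the same curve of D(I) exactly when their intervals are on the
same boundary component of G(I) ([connect_interval_of], [interval_of_connect]).
The local reason is [smooth_arrow_in].  Where the boundary of a vertex disk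
reaches an arrow, the A-resolution goes past the arrow along the same disk,
whereas the B-resolution jumps to the end of the other arrow of the crossing,
from where the boundary of the disk carrying that arrow leaves; this is the path
along the side of the band.  The orientation, through [dor_bor], is what makes
the jump land where the boundary leaves rather than where it arrives.

Taking preimages under that surjection is then an injective map on sets of
points which carries the curves at each vertex of one cube onto the curves at
the same vertex of the other.  Being one map for all vertices, it also preserves
which curves two vertices share, so it matches merges with merges, splits with
splits and hence all matrix coefficients of the differentials
([cube_dcoef_lift]).  A bijection of bases that respects coefficients and shifts
the degrees induces the isomorphism in homology ([homology_reindex]).  In the
reduced case, marked points correspond exactly when the surjection sends one to
the other ([interval_ofE]). *)

Set Implicit Arguments.
Unset Strict Implicit.
Unset Printing Implicit Defensive.

Import GRing.Theory.
Local Open Scope ring_scope.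

(** * Homology under a change of basis *)

Lemma additive_of_morph (U V : zmodType) (f : U -> V) :
  {morph f : x y / x - y} -> exists F : {additive U -> V}, F =1 f.
Proof.
move=> fB; pose F : {additive U -> V} :=
  HB.pack f (GRing.isZmodMorphism.Build _ _ f fB).
by exists F.
Qed.

Section QuotientBijection.
Local Open Scope quotient_scope.

Lemma quotient_additive_bij (U V : zmodType)
    (A : zmodClosed U) (B : zmodClosed V) (f : U -> V) (g : V -> U) :
    {morph f : x y / x - y} -> cancel f g -> cancel g f ->
    (forall x, (f x \in B) = (x \in A)) ->
  exists F : {additive Quotient.quot A -> Quotient.quot B}, bijective F.
Proof.
move=> fB fK gK fAB.
have gB : {morph g : x y / x - y}.
  by move=> x y; apply: (can_inj fK); rewrite fB !gK.
pose F (u : Quotient.quot A) : Quotient.quot B :=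
  \pi_(Quotient.quot B) (f (repr u)).
pose G (v : Quotient.quot B) : Quotient.quot A :=
  \pi_(Quotient.quot A) (g (repr v)).
have Fpi x : F (\pi x) = \pi_(Quotient.quot B) (f x).
  apply/eqP; rewrite -Quotient.idealrBE -fB fAB Quotient.idealrBE.
  by rewrite reprK.
have Gpi x : G (\pi x) = \pi_(Quotient.quot A) (g x).
  apply/eqP; rewrite -Quotient.idealrBE -gB -fAB gK Quotient.idealrBE.
  by rewrite reprK.
have FB : {morph F : x y / x - y}.
  move=> x y; rewrite -[x]reprK -[y]reprK -raddfB !Fpi fB.
  by rewrite raddfB.
have [H eH] := additive_of_morph FB.
by exists H; exists G => x; rewrite eH -[x]reprK ?(Fpi, Gpi) ?fK ?gK.
Qed.

End QuotientBijection.

Section ReindexComplex.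
Variables (C C' : complex) (r s : int) (f : basis C -> basis C').
Hypothesis f_bij : bijective f.
Hypothesis f_hdeg : forall b, hdeg (f b) = hdeg b + r.
Hypothesis f_qdeg : forall b, qdeg (f b) = qdeg b + s.
Hypothesis f_dcoef : forall b c, dcoef (f b) (f c) = dcoef b c.

(** Chains are functions on the basis, so the natural direction is backwards
along [f]; pushing them forward would need the inverse of [f]. *)
Let pullback (y : chain C') : chain C := [ffun b => y (f b)].

Lemma pullbackB : {morph pullback : x y / x - y}.
Proof. by move=> x y; apply/ffunP => b; rewrite !ffunE. Qed.

Lemma pullback_diff y : diff (pullback y) = pullback (diff y).
Proof.
apply/ffunP => b; rewrite !ffunE [RHS](reindex f) /=; last exact: onW_bij.
by apply: eq_bigr => c _; rewrite ffunE f_dcoef.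
Qed.

Lemma pullback_homogeneous i j y :
  homogeneous (i - r) (j - s) (pullback y) = homogeneous i j y.
Proof.
have [g fK gK] := f_bij.
have addr_eq x k a : (x + k == a :> int) = (x == a - k).
  by rewrite -subr_eq opprK.
by apply/forallP/forallP => h b;
  [rewrite -[b]gK; have := h (g b) | have := h (f b)];
  rewrite ffunE f_hdeg f_qdeg !addr_eq.
Qed.

Let pullback_bij : bijective pullback.
Proof.
have [g fK gK] := f_bij.
pose push (x : chain C) : chain C' := [ffun b => x (g b)].
by exists push => x; apply/ffunP => b; rewrite !ffunE ?fK ?gK.
Qed.

(** The two complexes are the same matrix up to a relabelling of the basis and a
shift of the degrees, so cycles and boundaries are identified. *)
Lemma homology_reindex :
  bigraded_iso (shift (homology C) r s) (homology C').
Proof.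
move=> i j; have [unpull pK uK] := pullback_bij.
have pull_cycle y :
    (pullback y \in @is_cycle C (i - r) (j - s)) = (y \in @is_cycle C' i j).
  rewrite !unfold_in /is_cycle pullback_homogeneous pullback_diff.
  by congr (_ && _); rewrite -(inj_eq (can_inj pK)) (_ : pullback 0 = 0) //;
     apply/ffunP => b; rewrite !ffunE.
have unpull_cycle (z : cycles C (i - r) (j - s)) :
    unpull (val z) \in @is_cycle C' i j.
  by rewrite -pull_cycle uK (valP z).
pose push (z : cycles C (i - r) (j - s)) : cycles C' i j :=
  Cycle (unpull_cycle z).
have pull_cycle' (z : cycles C' i j) :
    pullback (val z) \in @is_cycle C (i - r) (j - s).
  by rewrite pull_cycle (valP z).
pose pull (z : cycles C' i j) : cycles C (i - r) (j - s) :=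
  Cycle (pull_cycle' z).
have pushK : cancel push pull by move=> z; apply: val_inj; rewrite /= uK.
have pullK : cancel pull push by move=> z; apply: val_inj; rewrite /= pK.
apply: (@quotient_additive_bij _ _
         (@is_boundary C (i - r) (j - s)) (@is_boundary C' i j) push pull)
  => // [x y|x].
  apply: val_inj; apply: (can_inj pK).
  by rewrite [LHS]/= raddfB pullbackB /= !uK.
apply/boolp.asboolP/boolp.asboolP => -[y hy dy].
  exists (pullback y); last by rewrite pullback_diff dy /= uK.
  by rewrite addrAC pullback_homogeneous.
exists (unpull y); last by apply: (can_inj pK); rewrite -pullback_diff /= !uK.
by rewrite -pullback_homogeneous addrAC uK.
Qed.

End ReindexComplex.

(** * Cubes of curves under a surjection of points *)

Section CoverCube.
Variables (n : nat) (P P' : finType).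
Variables (c : {set 'I_n} -> rel P) (c' : {set 'I_n} -> rel P') (phi : P' -> P).
Hypothesis phi_surj : forall a, exists p, phi p = a.
Hypothesis phi_connect : forall I p q,
  connect (c' I) p q = connect (c I) (phi p) (phi q).

Let Q : cube := Cube c.
Let Q' : cube := Cube c'.

(** The same map serves at all vertices of the cube, which is what makes it
compatible with comparing the curves of two vertices. *)
Definition lift_set (C : {set P}) : {set P'} := phi @^-1: C.

Lemma lift_set_inj : injective lift_set.
Proof.
move=> A B /setP eAB; apply/setP => a; have [p <-] := phi_surj a.
by have := eAB p; rewrite !inE.
Qed.

Lemma lift_curve_of (I : {set 'I_n}) p :
  @curve_of Q' I p = lift_set (@curve_of Q I (phi p)).
Proof. by apply/setP => q; rewrite !inE; apply: phi_connect. Qed.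

(** A curve of [Q'] is the full preimage of a curve of [Q] because connectedness
is read off from the images of points, and every curve of [Q] has a nonempty
preimage because [phi] is surjective. *)
Lemma lift_curves (I : {set 'I_n}) :
  @curves Q' I = lift_set @: @curves Q I.
Proof.
apply/setP => C; apply/imsetP/imsetP => [[p _ ->]|[_ /imsetP[a _ ->] ->]].
  by exists (@curve_of Q I (phi p)); [apply: imset_f | apply: lift_curve_of].
by have [p <-] := phi_surj a; exists p; rewrite ?lift_curve_of.
Qed.

Lemma lift_state_subproof (s : state Q) :
  lift_set @: (val s).2 \subset @curves Q' (vertex s).
Proof. by rewrite lift_curves; apply: imsetS; apply: (valP s). Qed.

Definition lift_state (s : state Q) : state Q' :=
  exist (fun u : {set 'I_n} * {set {set P'}} => u.2 \subset @curves Q' u.1)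
    (vertex s, lift_set @: (val s).2) (lift_state_subproof s).

Lemma lift_state_bij : bijective lift_state.
Proof.
have lower_sub (t : state Q') :
    (lift_set @^-1: (val t).2) \subset @curves Q (vertex t).
  apply/subsetP => A; rewrite inE => At.
  have := subsetP (valP t) _ At; rewrite lift_curves mem_imset //.
  exact: lift_set_inj.
pose lower (t : state Q') : state Q :=
  exist (fun u : {set 'I_n} * {set {set P}} => u.2 \subset @curves Q u.1)
    (vertex t, lift_set @^-1: (val t).2) (lower_sub t).
exists lower => [s|t]; apply: val_inj; rewrite [RHS]surjective_pairing;
  congr pair.
  by apply/setP => A; rewrite inE mem_imset //; apply: lift_set_inj.
apply/setP => A; apply/imsetP/idP => [[B]|At]; first by rewrite inE => ? ->.
have := subsetP (valP t) _ At; rewrite lift_curves => /imsetP[B _ eA].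
by exists B; rewrite // inE -eA.
Qed.

Lemma curves_lift_state s :
  curves (vertex (lift_state s)) = lift_set @: curves (vertex s).
Proof. exact: lift_curves. Qed.

Lemma label_lift s C : label (lift_state s) (lift_set C) = label s C.
Proof. by rewrite /label /= mem_imset //; apply: lift_set_inj. Qed.

Lemma lift_state_qdeg s : state_qdeg (lift_state s) = state_qdeg s.
Proof.
rewrite /state_qdeg {2}/vertex /= -/(vertex s); congr (_ + _).
rewrite curves_lift_state big_imset /=; last exact: in2W lift_set_inj.
by apply: eq_bigr => C _; rewrite label_lift.
Qed.

Lemma lift_setD X Y :
  lift_set @: (X :\: Y) = (lift_set @: X) :\: (lift_set @: Y).
Proof.
have memE := mem_imset _ _ lift_set_inj.
apply/setP => C; apply/imsetP/setDP => [[A /setDP[AX nAY] ->]|].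
  by rewrite !memE.
by case=> /imsetP[A AX ->]; rewrite memE => nAY; exists A; rewrite // inE nAY.
Qed.

Lemma lost_lift s t : lost (lift_state s) (lift_state t) = lift_set @: lost s t.
Proof. by rewrite /lost !curves_lift_state lift_setD. Qed.

Lemma gained_lift s t :
  gained (lift_state s) (lift_state t) = lift_set @: gained s t.
Proof. by rewrite /gained !curves_lift_state lift_setD. Qed.

Lemma same_elsewhere_lift s t :
  same_elsewhere (lift_state s) (lift_state t) = same_elsewhere s t.
Proof.
rewrite /same_elsewhere !curves_lift_state -imsetI; last first.
  exact: in2W lift_set_inj.
apply/forall_inP/forall_inP => h C.
  by move=> hC; have := h _ (imset_f _ hC); rewrite !label_lift.
by case/imsetP => A hA ->; rewrite !label_lift; apply: h.
Qed.

(** The curves affected by a lifted hypercube edge are lifts themselves, so the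
curves witnessing a merge or a split can be brought back to [Q]. *)
Lemma imset_lift_eq1 (X : {set {set P}}) A : (lift_set @: X == [set A]) ->
  exists2 B, A = lift_set B & X = [set B].
Proof.
move/eqP=> e; have /imsetP[B BX eA] : A \in lift_set @: X by rewrite e set11.
by exists B => //; apply: (imset_inj lift_set_inj); rewrite e eA imset_set1.
Qed.

Lemma imset_lift_eq2 (X : {set {set P}}) A B : (lift_set @: X == [set A; B]) ->
  exists A', exists B',
    [/\ A = lift_set A', B = lift_set B' & X = [set A'; B']].
Proof.
move/eqP=> e; have /imsetP[A' _ eA] : A \in lift_set @: X by rewrite e set21.
have /imsetP[B' _ eB] : B \in lift_set @: X by rewrite e set22.
exists A', B'; split=> //.
by apply: (imset_inj lift_set_inj); rewrite e eA eB imsetU1 imset_set1.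
Qed.

Lemma merge_coef_lift s t :
  merge_coef (lift_state s) (lift_state t) = merge_coef s t.
Proof.
rewrite /merge_coef lost_lift gained_lift; apply/idP/idP.
  case/existsP=> A /existsP[B /existsP[C /and4P[nAB lAB gC hm]]].
  have [A' [B' [eA eB eL]]] := imset_lift_eq2 lAB.
  have [C' eC eG] := imset_lift_eq1 gC; subst A B C.
  apply/existsP; exists A'; apply/existsP; exists B'; apply/existsP; exists C'.
  by move: hm; rewrite !label_lift eL eG !eqxx (contraNneq _ nAB) // => ->.
case/existsP=> A /existsP[B /existsP[C /and4P[nAB /eqP-> /eqP-> hm]]].
apply/existsP; exists (lift_set A); apply/existsP; exists (lift_set B).
apply/existsP; exists (lift_set C).
by rewrite !label_lift hm imsetU1 !imset_set1 !eqxx (inj_eq lift_set_inj) nAB.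
Qed.

Lemma split_coef_lift s t :
  split_coef (lift_state s) (lift_state t) = split_coef s t.
Proof.
rewrite /split_coef lost_lift gained_lift; apply/idP/idP.
  case/existsP=> A /existsP[B /existsP[C /and4P[nBC lA gBC hm]]].
  have [A' eA eL] := imset_lift_eq1 lA.
  have [B' [C' [eB eC eG]]] := imset_lift_eq2 gBC; subst A B C.
  apply/existsP; exists A'; apply/existsP; exists B'; apply/existsP; exists C'.
  by move: hm; rewrite !label_lift eL eG !eqxx (contraNneq _ nBC) // => ->.
case/existsP=> A /existsP[B /existsP[C /and4P[nBC /eqP-> /eqP-> hm]]].
apply/existsP; exists (lift_set A); apply/existsP; exists (lift_set B).
apply/existsP; exists (lift_set C).
by rewrite !label_lift hm imsetU1 !imset_set1 !eqxx (inj_eq lift_set_inj) nBC.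
Qed.

(** The sign of a hypercube edge depends only on the vertices, which are the
same for a state and its lift. *)
Lemma cube_dcoef_lift s t :
  cube_dcoef (lift_state s) (lift_state t) = cube_dcoef s t.
Proof.
apply: eq_bigr => k _; congr (_ * _).
by rewrite /edge_coef same_elsewhere_lift merge_coef_lift split_coef_lift.
Qed.

Lemma cube_homology_lift r s :
  bigraded_iso (shift (homology (cube_complex Q)) r s)
               (homology (shift_complex (cube_complex Q') r s)).
Proof.
apply: (@homology_reindex (cube_complex Q) (shift_complex (cube_complex Q') r s)
          r s lift_state) => //.
- exact: lift_state_bij.
- by move=> b; congr (_ + _); apply: lift_state_qdeg.
- exact: cube_dcoef_lift.
Qed.

Lemma reduced_cube_homology_lift (p : P') r s :
  bigraded_iso (shift (homology (@reduced_cube_complex Q (phi p))) r s)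
               (homology (shift_complex (@reduced_cube_complex Q' p) r s)).
Proof.
pose red (x : state Q) := ~~ label x (@curve_of Q (vertex x) (phi p)).
pose red' (x : state Q') := ~~ label x (@curve_of Q' (vertex x) p).
have red_lift x : red' (lift_state x) = red x.
  by rewrite /red' lift_curve_of label_lift.
have lift_red (x : {x | red x}) : red' (lift_state (val x)).
  by rewrite red_lift (valP x).
pose f (x : {x | red x}) : {x | red' x} :=
  exist red' (lift_state (val x)) (lift_red x).
apply: (@homology_reindex (@reduced_cube_complex Q (phi p))
          (shift_complex (@reduced_cube_complex Q' p) r s) r s f) => //.
- have [lower liftK lowerK] := lift_state_bij.
  have lowP (x : {x | red' x}) : red (lower (val x)).
    by rewrite -red_lift lowerK (valP x).
  exists (fun x => exist red (lower (val x)) (lowP x)) => x; apply: val_inj.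
    exact: liftK.
  exact: lowerK.
- by move=> b; congr (_ + _ + _); apply: lift_state_qdeg.
- by move=> x y; apply: cube_dcoef_lift.
Qed.

End CoverCube.

(** * The curves of a resolution *)

Section Resolution.
Variable D : vdiagram.
Implicit Types (I : {set 'I_(nclassical D)}) (h : cend D) (p q : dpoint D).

Lemma smoothK I : involutive (smooth I).
Proof.
by case=> [[x|v] c]; rewrite /smooth /=; [case: (x \in I); case: c | case: c].
Qed.

Lemma smooth_noarrow I h : arrow h = None -> smooth I h = smooth set0 h.
Proof. by case: h => [[x|v] c]. Qed.

Lemma resolution_connect_sym I : connect_sym (@resolution_adj D I).
Proof.
apply: sym_connect_sym => -[h|f] [h'|f'] //=.
rewrite (inv_eq (@mateK D)) (inv_eq (smoothK I)).
by rewrite ![h == _]eq_sym.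
Qed.

Lemma curveE I C p :
  C \in curves (Q := diagram_cube D) I -> p \in C ->
  C = curve_of (Q := diagram_cube D) I p.
Proof.
case/imsetP=> p0 _ ->; rewrite inE => p0p; apply/setP => q; rewrite !inE.
exact: (same_connect (@resolution_connect_sym I)) p0p q.
Qed.

Lemma curve_adj I C p q :
  C \in curves (Q := diagram_cube D) I -> p \in C -> resolution_adj I p q ->
  q \in C.
Proof. by move=> CI pC pq; rewrite (curveE CI pC) inE connect1. Qed.

Lemma arrowless_noarrow C h : arrowless C -> inl h \in C -> arrow h = None.
Proof.
by case/andP=> _ /forallP/(_ h)/implyP nC /nC; case: (arrow h).
Qed.

(** A curve of the all-A resolution that meets no classical crossing is a curve
of every other resolution as well: changing a resolution does not touch it. *)
Lemma arrowless_connect I C p q :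
  arrowless C -> p \in C -> q \in C -> connect (@resolution_adj D I) p q.
Proof.
move=> aC pC; have /andP[C0 _] := aC.
rewrite (curveE C0 pC) inE => /connectP[s]; elim: s p pC => [|r s IH] p pC /=.
  by move=> _ ->; apply: connect0.
case/andP=> pr ps eq; have rC := curve_adj C0 pC pr.
apply: connect_trans (IH r rC ps eq); apply: connect1.
case: p r pC pr {rC ps eq} => [h|f] [h'|f'] //= pC.
by rewrite (smooth_noarrow I) //; apply: arrowless_noarrow pC.
Qed.

End Resolution.

(** * Intervals of the all-A ribbon graph *)

Section AllA.
Variables (D : vdiagram) (o : allA_orientation D).
Implicit Types (I : {set 'I_(nclassical D)}) (h : cend D) (p : dpoint D).
Implicit Types (a : 'I_(nclassical D) * bool).

(** Advancing along the boundary of a disk by one end rotates the cyclic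
sequence of ends by one place, so it rotates the sequence of arrows by one place
if an arrow is passed, and otherwise leaves it unchanged. *)
Lemma arrows_from_step h : exists s,
  arrows_from h = seq_of_opt (arrow h) ++ s /\
  arrows_from (allA_step h) = s ++ seq_of_opt (arrow h).
Proof.
have inj := @allA_step_inj D.
have ord : order (@allA_step D) (allA_step h) = order (@allA_step D) h.
  by apply: eq_card => k; symmetry; apply: (same_fconnect1 inj).
exists (pmap (@arrow D)
  (traject (@allA_step D) (allA_step h) (order (@allA_step D) h).-1)).
rewrite /arrows_from /orbit ord -orderSpred; split.
  by rewrite /=; case: (arrow h).
rewrite trajectSr -cats1 pmap_cat; congr (_ ++ _).
by rewrite -iterSr orderSpred iter_order //=; case: (arrow h).
Qed.

Lemma arrows_from_noarrow h :
  arrow h = None -> arrows_from (allA_step h) = arrows_from h.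
Proof.
by have [s [-> ->]] := arrows_from_step h; move=> ->; rewrite cats0.
Qed.

Lemma ohead_arrows_from h a :
  arrow h = Some a -> ohead (arrows_from h) = Some a.
Proof. by have [s [-> _]] := arrows_from_step h; move=> ->. Qed.

Lemma ohead_arrows_from_step a :
  ohead (arrows_from (allA_step (arrow_in o a))) = Some (allA_next o a).
Proof.
have [s] := arrows_from_step (arrow_in o a).
rewrite arrow_arrow_in /allA_next /= => -[-> ->].
by case: s => [|b s] /=; rewrite ?eqxx.
Qed.

Lemma arrows_from_curve C h a :
    C \in curves (Q := diagram_cube D) set0 -> inl h \in C ->
  a \in arrows_from h -> exists2 k, inl k \in C & arrow k = Some a.
Proof.
move=> C0 hC; rewrite mem_pmap => /mapP[k]; rewrite -fconnect_orbit.
move=> /iter_findex <- ek.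
exists (iter (findex (@allA_step D) h k) (@allA_step D) h) => //.
elim: (findex _ _ _) => //= m IH.
have : inl (smooth set0 (iter m (@allA_step D) h)) \in C.
  by apply: curve_adj C0 IH _; rewrite /= eqxx orbT.
by move/(curve_adj C0); apply; rewrite /= eqxx.
Qed.

(** Every resolution respects the orientation of the disks, not only the all-A
one.  At a B-resolution this is [dor_bor]: as the two arrows at a crossing agree
with one orientation of the band, the disk orientations treat their tails alike,
so the B-resolution joins an end where a boundary arrives to one where a
boundary leaves. *)
Lemma dor_smooth_any I h : dor o (smooth I h) = ~~ dor o h.
Proof.
rewrite -(dor_smooth o h); case: h => [[x|v] c] //=.
rewrite /smooth /= in_set0; case: (x \in I) => //.
have tT : dor o (inl x, NE) = ~~ bor o x := dor_bor o x true.
have tF : dor o (inl x, SW) = ~~ bor o x := dor_bor o x false.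
have := dor_smooth o (inl x, NE); have := dor_smooth o (inl x, SW).
by rewrite /smooth /= in_set0 => hF hT; case: c; rewrite /= ?hF ?hT ?tF ?tT.
Qed.

(** A point lies on one curve of the all-A resolution only.  An arrow met from
the point is on this curve too, so the curve cannot be the boundary of an
isolated vertex at the same time. *)
Lemma corresponding_inj p q q' :
  corresponding (o := o) p q -> corresponding p q' -> q = q'.
Proof.
have mixed a C :
    corresponding (o := o) p (inl a) -> ~ corresponding (o := o) p (inr C).
  move=> [h -> ha] /= hC; have aC := valP C; have /andP[C0 _] := aC.
  set g := (if _ then _ else _) in ha.
  have gC : inl g \in val C.
    rewrite /g; case: ifP => // _.
    by apply: curve_adj C0 hC _; rewrite /= eqxx.
  have ag : a \in arrows_from g.
    by case: (arrows_from g) ha => //= b s [->]; rewrite mem_head.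
  have [k kC ek] := arrows_from_curve C0 gC ag.
  by rewrite (arrowless_noarrow aC kC) in ek.
case: q q' => [a|C] [b|C'] pq pq'.
- by case: pq pq' => h -> ha [_ [<-]]; rewrite ha => -[->].
- by case: (mixed _ _ pq pq').
- by case: (mixed _ _ pq' pq).
- have /andP[C0 _] := valP C; have /andP[C0' _] := valP C'.
  by congr inr; apply: val_inj; rewrite /= (curveE C0 pq) (curveE C0' pq').
Qed.

(** Well defined by [corresponding_total] and [corresponding_inj]. *)
Definition interval_of p : rarc (allA_graph o) :=
  projT1 (boolp.cid (corresponding_total o p)).

Lemma interval_ofP p : corresponding p (interval_of p).
Proof. exact: (projT2 (boolp.cid (corresponding_total o p))). Qed.

Lemma interval_ofE p q : corresponding p q -> interval_of p = q.
Proof. exact: corresponding_inj (interval_ofP p). Qed.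

Lemma interval_of_mate h : interval_of (inl (mate h)) = interval_of (inl h).
Proof.
apply: interval_ofE; have := interval_ofP (inl h).
case: (interval_of _) => [a [_ [<-] ha]|C hC] /=.
  by exists (mate h); rewrite // dor_mate mateK; case: (dor o h) ha.
by have /andP[C0 _] := valP C; apply: curve_adj C0 hC _; rewrite /= eqxx.
Qed.

Lemma interval_of_dor h a :
  dor o h -> ohead (arrows_from h) = Some a -> interval_of (inl h) = inl a.
Proof. by move=> oh ha; apply: interval_ofE; exists h; rewrite ?oh. Qed.

Lemma interval_of_arrow_in a : interval_of (inl (arrow_in o a)) = inl a.
Proof.
apply: interval_of_dor; first exact: dor_arrow_in.
by apply: ohead_arrows_from; apply: arrow_arrow_in.
Qed.

Lemma interval_of_arrow_out a :
  interval_of (inl (smooth set0 (arrow_in o a))) = inl (allA_next o a).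
Proof.
rewrite -interval_of_mate; apply: interval_of_dor; last first.
  exact: ohead_arrows_from_step.
by rewrite dor_step dor_arrow_in.
Qed.

(** At a virtual crossing no arrow is passed, so the first arrow ahead is the
same on both sides of it. *)
Lemma interval_of_noarrow h :
  arrow h = None -> interval_of (inl (smooth set0 h)) = interval_of (inl h).
Proof.
wlog oh : h / dor o h => [th|] nh.
  have [/th->//|] := boolP (dor o h); rewrite -dor_smooth => oh.
  rewrite -(th _ oh) ?smooth0K //.
  by case: h nh {th oh} => [[x|v] c].
apply: interval_ofE; have := interval_ofP (inl h).
case: (interval_of _) => [a [_ [<-] ha]|C hC] /=.
  exists (smooth set0 h); rewrite // dor_smooth oh /=.
  by rewrite -[mate _]/(allA_step h) arrows_from_noarrow // -ha oh.
have /andP[C0 _] := valP C; apply: curve_adj C0 hC _.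
by rewrite /= eqxx orbT.
Qed.

(** From the end of a boundary interval, every resolution leads to the beginning
of one: the one after the same arrow for A, the one after the other arrow of the
crossing for B, as when following the side of a band.  By [dor_bor] the boundary
runs alike along the two arrows of a crossing, both times from tail to head or
both times from head to tail.  The arcs of the B-resolution join the tail of each
arrow to the head of the other, so the end reached on one arrow is joined to the
end left from on the other. *)
Lemma smooth_arrow_in I a :
  smooth I (arrow_in o a) =
  smooth set0 (arrow_in o (if a.1 \in I then (a.1, ~~ a.2) else a)).
Proof.
case: a => x b; rewrite /smooth /arrow_in /=.
case: ifP => //= _; last by rewrite in_set0.
by rewrite in_set0 !dor_bor; case: (bor o x); case: b.
Qed.

Lemma interval_of_smooth_arrow_in I a :
  interval_of (inl (smooth I (arrow_in o a))) =
  @boundary_next (allA_graph o) I (inl a).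
Proof.
by rewrite smooth_arrow_in interval_of_arrow_out /= permE.
Qed.

Lemma boundary_next_inj (G : ribbon_graph) (I : {set 'I_(redges G)}) :
  injective (@boundary_next G I).
Proof.
move=> [[x b]|v] [[y b']|v'] //= [].
move/perm_inj; case: ifP => xI; case: ifP => yI [exy];
  rewrite -?exy ?xI in yI * => // eb.
- by case: b b' eb => [] [].
- by rewrite eb.
Qed.

Lemma interval_of_smooth I h :
  fconnect (@boundary_next (allA_graph o) I)
    (interval_of (inl h)) (interval_of (inl (smooth I h))).
Proof.
(* Going along the arc backwards exchanges its two ends, of which exactly one is
   an end where the boundary of a disk arrives. *)
wlog oh : h / dor o h => [th|].
  have [/th//|] := boolP (dor o h); rewrite -(dor_smooth_any I) => /th.
  by rewrite smoothK fconnect_sym //; apply: boundary_next_inj.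
case eh: (arrow h) => [a|]; last first.
  by rewrite smooth_noarrow // interval_of_noarrow.
rewrite -(arrow_inK oh eh) interval_of_smooth_arrow_in interval_of_arrow_in.
exact: fconnect1.
Qed.

Lemma connect_interval_of I p p' :
  connect (@resolution_adj D I) p p' ->
  fconnect (@boundary_next (allA_graph o) I) (interval_of p) (interval_of p').
Proof.
case/connectP=> s; elim: s p => [|r s IH] p /=; first by move=> _ ->.
case/andP=> pr ps es; apply: connect_trans (IH r ps es).
case: p r pr {ps es} => [h|f] [h'|f'] //= /orP[] /eqP <-.
  by rewrite interval_of_mate.
exact: interval_of_smooth.
Qed.

(** Up to the first arrow only virtual crossings are met, where all resolutions
agree; hence the part of a disk boundary before an arrow belongs to one curve of
every resolution. *)
Lemma arrow_in_reached I n h a :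
  ohead (pmap (@arrow D) (traject (@allA_step D) h n)) = Some a -> dor o h ->
  connect (@resolution_adj D I) (inl h) (inl (arrow_in o a)).
Proof.
elim: n h => //= n IH h; case eh: (arrow h) => [b|] /=.
  by move=> [<-] oh; rewrite (arrow_inK oh eh).
move=> ha oh; have := IH _ ha; rewrite dor_step => /(_ oh).
apply: connect_trans; apply: (@connect_trans _ _ (inl (smooth I h))).
  by apply: connect1; rewrite /= eqxx orbT.
by apply: connect1; rewrite /= (smooth_noarrow I eh) eqxx.
Qed.

Lemma interval_of_arrow I p a :
  interval_of p = inl a -> connect (@resolution_adj D I) p (inl (arrow_in o a)).
Proof.
move=> pa; have := interval_ofP p; rewrite pa => -[h ->] /arrow_in_reached ha.
case: ifP ha => oh ha; first exact: ha.
apply: connect_trans (ha I _); last by rewrite dor_mate oh.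
by apply: connect1; rewrite /= eqxx.
Qed.

Lemma same_interval_connect I p p' :
  interval_of p = interval_of p' -> connect (@resolution_adj D I) p p'.
Proof.
case ep: (interval_of p) => [a|C] /esym ep'.
  apply: connect_trans (interval_of_arrow I ep) _.
  rewrite resolution_connect_sym; exact: interval_of_arrow.
have := interval_ofP p; have := interval_ofP p'; rewrite ep ep' /= => p'C pC.
exact: arrowless_connect (valP C) pC p'C.
Qed.

Lemma interval_of_connect I p p' :
  fconnect (@boundary_next (allA_graph o) I) (interval_of p) (interval_of p') ->
  connect (@resolution_adj D I) p p'.
Proof.
case/connectP=> s; elim: s p => [|b s IH] p /=.
  by move=> _ /esym; apply: same_interval_connect.
case/andP=> /eqP eb; rewrite -{}eb.
(* It is enough to move [p] along its curve to a point of the next interval. *)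
suff [r <- pr] : exists2 r,
    interval_of r = @boundary_next (allA_graph o) I (interval_of p)
    & connect (@resolution_adj D I) p r.
  by move=> ps es; apply: connect_trans pr (IH r ps es).
case ep: (interval_of p) => [a|C]; last by exists p.
exists (inl (smooth I (arrow_in o a))).
  exact: interval_of_smooth_arrow_in.
apply: connect_trans (interval_of_arrow I ep) _.
by apply: connect1; rewrite /= eqxx orbT.
Qed.

Lemma interval_of_surj q : exists p, interval_of p = q.
Proof.
case: q => [a|C].
  by exists (inl (arrow_in o a)); apply: interval_of_arrow_in.
have /andP[/imsetP[p _ eC] _] := valP C; exists p.
by apply: interval_ofE; rewrite /= eC inE connect0.
Qed.

End AllA.

(** * Comparison of the homologies *)

Theorem theorem5p2 (D : vdiagram) (o : allA_orientation D) :
  bigraded_iso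
    (shift (Kh_ribbon (allA_graph o))
       (- (nneg D)%:Z) ((npos D)%:Z - 2 * (nneg D)%:Z))
    (Kh_link D)
  /\ (forall (p : dpoint D) (q : rarc (allA_graph o)), corresponding p q ->
        bigraded_iso
          (shift (rKh_ribbon q)
             (- (nneg D)%:Z) ((npos D)%:Z - 2 * (nneg D)%:Z))
          (rKh_link p)).
Proof.
have same_components (I : {set 'I_(nclassical D)}) p p' :
    connect (@resolution_adj D I) p p' =
    fconnect (@boundary_next (allA_graph o) I)
      (interval_of o p) (interval_of o p').
  by apply/idP/idP => [/(connect_interval_of o)|/interval_of_connect].
split=> [|p q /interval_ofE <-].
  exact: cube_homology_lift (interval_of_surj (o := o)) same_components _ _.
exact: reduced_cube_homology_lift (interval_of_surj (o := o))
  same_components _ _ _.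
Qed.
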